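(* Let $m,\lambda,k\geq 1$ be integers and let $L$ be a Latin square of order $m$. If $L$ has a $k$-plex and $k$ divides $\lambda$, then $L(\lambda)$ has a balanced diagonal. In particular, if $L$ has a transversal, then $L(\lambda)$ has a balanced diagonal for every integer $\lambda\geq 1$.
   Context: A Latin square of order $m$ is an $m\times m$ array with entries from $\{1,\dots,m\}$ in which each symbol occurs exactly once in each row and each column. A frequency square of type $F(m\lambda;\lambda^m)$ is an $m\lambda\times m\lambda$ array with entries from $\{1,\dots,m\}$ in which each symbol occurs exactly $\lambda$ times in each row and exactly $\lambda$ times in each column. Given a Latin square $L$ of order $m$, $L(\lambda)$ is the frequency square of type $F(m\lambda;\lambda^m)$ obtained by replacing each cell of $L$ containing entry $e$ with a $\lambda\times\lambda$ block of $e$'s; that is, the entry of $L(\lambda)$ in cell $(i,j)$ is $L_{\lceil i/\lambda\rceil,\lceil j/\lambda\rceil}$. A $k$-plex in a Latin square is a subset of its cells in which each row, each column and each entry is represented exactly $k$ times; a transversal is a $1$-plex. A diagonal of a square array is a set of cells that uses each row and each column exactly once. A diagonal of a frequency square of type $F(m\lambda;\lambda^m)$ is balanced if each symbol in $\{1,\dots,m\}$ occurs in exactly $\lambda$ of its cells. *)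

(* Defs.v *)
From HB Require Import structures.
From mathcomp Require Import all_boot all_order all_algebra.

Set Implicit Arguments.
Unset Strict Implicit.
Unset Printing Implicit Defensive.

(* Rows, columns and symbols are numbered from 0; the cell in row i and
   column j is the pair (i, j), and a set of cells is a {set 'I_n * 'I_n}. *)

Definition latin_square (m : nat) (L : 'M['I_m]_m) : Prop :=
  (forall i s, #|[set j | L i j == s]| = 1) /\
  (forall j s, #|[set i | L i j == s]| = 1).

Definition frequency_square (m lambda : nat)
    (F : 'M['I_m]_(m * lambda)) : Prop :=
  (forall i s, #|[set j | F i j == s]| = lambda) /\
  (forall j s, #|[set i | F i j == s]| = lambda).

Lemma block_index_subproof (m lambda : nat) (i : 'I_(m * lambda)) :
  i %/ lambda < m.
Proof.
by case: lambda i => [|l] i; [case: i => i; rewrite muln0 | rewrite ltn_divLR].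
Qed.

(* Numbering from 0 turns the 1-based index ceil(i / lambda) into the
   0-based quotient i %/ lambda. *)
Definition block_index (m lambda : nat) (i : 'I_(m * lambda)) : 'I_m :=
  Ordinal (block_index_subproof i).

Definition inflate (m lambda : nat) (L : 'M['I_m]_m) : 'M['I_m]_(m * lambda) :=
  \matrix_(i, j) L (block_index i) (block_index j).

Definition plex (m k : nat) (L : 'M['I_m]_m) (P : {set 'I_m * 'I_m}) : Prop :=
  [/\ forall i, #|[set c in P | c.1 == i]| = k,
      forall j, #|[set c in P | c.2 == j]| = k
    & forall s, #|[set c in P | L c.1 c.2 == s]| = k].

Definition latin_transversal (m : nat) (L : 'M['I_m]_m) (P : {set 'I_m * 'I_m})
  : Prop := plex 1 L P.

Definition diagonal (n : nat) (D : {set 'I_n * 'I_n}) : Prop :=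
  (forall i, #|[set c in D | c.1 == i]| = 1) /\
  (forall j, #|[set c in D | c.2 == j]| = 1).

Definition balanced_diagonal (m lambda : nat) (F : 'M['I_m]_(m * lambda))
    (D : {set 'I_(m * lambda) * 'I_(m * lambda)}) : Prop :=
  diagonal D /\ forall s, #|[set c in D | F c.1 c.2 == s]| = lambda.

Lemma card_block (m lambda : nat) (b : 'I_m) :
  #|[set i : 'I_(m * lambda) | block_index i == b]| = lambda.
Proof.
have lt_idx (r : 'I_lambda) : b * lambda + r < m * lambda.
  apply: (@leq_trans (b.+1 * lambda)); first by rewrite mulSn addnC ltn_add2r.
  by rewrite leq_mul2r ltn_ord orbT.
pose f r := Ordinal (lt_idx r).
have f_inj : injective f by move=> r r' [/addnI /val_inj].
rewrite -[RHS](card_ord lambda) -(card_imset _ f_inj); apply: eq_card => i.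
rewrite inE; apply/eqP/imsetP => [bE|[r _ ->]].
  have lam_gt0 : 0 < lambda.
    by have := leq_ltn_trans (leq0n i) (ltn_ord i); rewrite muln_gt0 => /andP[].
  exists (Ordinal (ltn_pmod i lam_gt0)) => //.
  by apply: val_inj; rewrite /= -bE -divn_eq.
have lam_gt0 : 0 < lambda by apply: leq_ltn_trans (ltn_ord r).
by apply: val_inj; rewrite /= divnMDl // divn_small ?addn0.
Qed.

Lemma inflate_frequency_square (m lambda : nat) (L : 'M['I_m]_m) :
  latin_square L -> frequency_square (inflate lambda L).
Proof.
case=> rowL colL; split=> [i|j] s.
  have /eqP /cards1P [b /setP Eb] := rowL (block_index i) s.
  rewrite -[RHS](card_block lambda b); apply: eq_card => j.
  by have := Eb (block_index j); rewrite !inE mxE.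
have /eqP/cards1P[b /setP Eb] := colL (block_index j) s.
rewrite -[RHS](card_block lambda b); apply: eq_card => i.
by have := Eb (block_index i); rewrite !inE mxE.
Qed.

(* Main.v *)
(* Put q = lambda / k.  Let each cell (a, b) of the plex be used q times in
   its block of the inflated square.  Every block row and every block column
   then has q * k = lambda uses, so the uses in block row a can be matched
   bijectively with the rows of that block row, and likewise for columns;
   pairing the row and the column of each use gives the diagonal. *)
Require Import Defs.
From HB Require Import structures.
From mathcomp Require Import all_boot all_order all_algebra.

Set Implicit Arguments.
Unset Strict Implicit.
Unset Printing Implicit Defensive.

Lemma card_sum_fibers (T B : finType) (f : T -> B) :
  #|T| = \sum_b #|[set t | f t == b]|.
Proof.
rewrite -sum1_card (partition_big f xpredT) //.
by apply: eq_bigr => b _; rewrite sum1dep_card.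
Qed.

(** Enumerate every fibre; [h] sends [t] to the element of the same rank in the fibre of [g] over
    [f t]. *)
Lemma fiberwise_bijection (T U B : finType) (f : T -> B) (g : U -> B) :
    (forall b, #|[set t | f t == b]| = #|[set u | g u == b]|) ->
  exists2 h : T -> U, bijective h & forall t, g (h t) = f t.
Proof.
move=> eq_fg.
have in_f t : t \in [set t' | f t' == f t] by rewrite inE.
pose h t := enum_val (cast_ord (eq_fg (f t)) (enum_rank_in (in_f t) t)).
have gh t : g (h t) = f t.
  by have := enum_valP (cast_ord (eq_fg (f t)) (enum_rank_in (in_f t) t));
    rewrite inE => /eqP.
(* Injectivity suffices, since summing the fibre sizes gives [T] and [U] equal cardinality. *)
exists h => //; apply: inj_card_bij; last first.
  by rewrite (card_sum_fibers f) (card_sum_fibers g)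
    (eq_bigr _ (fun b _ => eq_fg b)).
move=> t t' eq_h; have eq_f : f t = f t' by rewrite -!gh eq_h.
(* The membership proofs are generalised so that rewriting with [eq_f] places both ranks in one and
   the same fibre. *)
move: eq_h; rewrite /h; move: (in_f t) (in_f t'); rewrite -eq_f => ft ft'.
move=> /enum_val_inj /cast_ord_inj /(congr1 enum_val).
by rewrite !enum_rankK_in.
Qed.

(** Used with [phi] the row, the column and the symbol of a cell; ['I_q] labels the [q] uses of each
    cell of [P]. *)
Lemma card_fiber_copies (C B : finType) (P : {set C}) (q : nat) (phi : C -> B)
    (b : B) :
  #|[set t : {c | c \in P} * 'I_q | phi (val t.1) == b]| =
    q * #|[set c in P | phi c == b]|.
Proof.
pose X := [set c : {c | c \in P} | phi (val c) == b].
have -> : [set t : {c | c \in P} * 'I_q | phi (val t.1) == b] = setX X setT.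
  by apply/setP => -[c r]; rewrite !inE andbT.
rewrite cardsX cardsT card_ord mulnC -(card_imset _ val_inj); congr (q * _).
apply: eq_card => c; rewrite inE; apply/imsetP/andP.
  by case=> x; rewrite inE => phix ->; split=> //; apply: valP.
by case=> Pc phic; exists (Sub c Pc); rewrite ?inE SubK.
Qed.

Lemma plex_balanced_diagonal (m k q : nat) (L : 'M['I_m]_m)
    (P : {set 'I_m * 'I_m}) :
  plex k L P -> exists D, balanced_diagonal (inflate (q * k) L) D.
Proof.
case=> rowP colP symP; pose T := ({c | c \in P} * 'I_q)%type.
(* Rows and columns are treated at once: [phi] will be the first, then the second projection. *)
have lines (phi : 'I_m * 'I_m -> 'I_m) :
    (forall b, #|[set c in P | phi c == b]| = k) ->
  exists2 h : T -> 'I_(m * (q * k)),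
    bijective h & forall t, block_index (h t) = phi (val t.1).
  move=> phiP; apply: fiberwise_bijection => b.
  by rewrite card_fiber_copies phiP card_block.
have [rho rho_bij rhoE] := lines _ rowP.
have [sigma sigma_bij sigmaE] := lines _ colP.
pose d t := (rho t, sigma t).
have d_inj : injective d by move=> t t' [/(bij_inj rho_bij)].
have cardD (p : pred ('I_(m * (q * k)) * 'I_(m * (q * k)))) :
    #|[set c in d @: setT | p c]| = #|[set t | p (d t)]|.
  rewrite -(card_imset _ d_inj); apply: eq_card => c.
  rewrite inE; apply/andP/imsetP => [[/imsetP[t _ ->] pt] | [t pt ->]].
    by exists t; rewrite ?inE.
  by rewrite imset_f //; move: pt; rewrite inE.
have card_bij (h : T -> 'I_(m * (q * k))) i :
    bijective h -> #|[set t | h t == i]| = 1.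
  case=> h' hK h'K; rewrite -(cards1 (h' i)); apply: eq_card => t.
  by rewrite !inE (can2_eq hK h'K).
exists (d @: setT); split; first by split=> i; rewrite cardD card_bij.
(* The cell [d t] lies in the block of the plex cell [val t.1], hence carries its symbol; by [symP]
   each symbol then gets [q * k] uses. *)
move=> s; rewrite cardD -[in RHS](symP s) -card_fiber_copies.
by apply: eq_card => t; rewrite !inE mxE rhoE sigmaE.
Qed.

Theorem theorem11 (m : nat) (L : 'M['I_m]_m) (m_gt0 : 0 < m)
    (latinL : latin_square L) :
  (forall lambda k : nat, 0 < lambda -> 0 < k ->
     (exists P, plex k L P) -> k %| lambda ->
     exists D, balanced_diagonal (inflate lambda L) D) /\
  ((exists P, latin_transversal L P) ->
     forall lambda : nat, 0 < lambda ->
     exists D, balanced_diagonal (inflate lambda L) D).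
Proof.
have main lambda k : (exists P, plex k L P) -> k %| lambda ->
    exists D, balanced_diagonal (inflate lambda L) D.
  by case=> P plexP /dvdnP[q ->]; apply: plex_balanced_diagonal plexP.
split=> [lambda k _ _ | transL lambda _]; first exact: main.
exact: main transL (dvd1n lambda).
Qed.
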